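(* Let $k$ be a field, let $n\ge 1$, and let $\mathcal{T}_n$ be the category of finite-dimensional nilpotent $k$-representations of the opposite $\Delta_n^{\mathrm{op}}$ of the cyclic quiver $\Delta_n$. Let $Z:G_0(\mathcal{T}_n)\to\mathbb{C}$ be a discrete stability function on $\mathcal{T}_n$. Then there is, up to isomorphism, a unique stable object $M\in\mathcal{T}_n$ with dimension vector $\underline{\dim}\,M=\delta=(1,1,\dots,1)$. In particular, all the nonzero subcategories $(\mathcal{T}_n)_\mu$, $\mu\in[0,\pi)$, are semisimple except exactly one, which is not semisimple and admits $M$ as its unique simple object (up to isomorphism). As a consequence, $\mathcal{T}_n$ does not admit a completely discrete stability function.
   Context: The cyclic quiver $\Delta_n$ has vertex set $Q_0=\{1,\dots,n\}$ and one arrow from $i$ to $i+1$ for each $i$ (indices modulo $n$). $S_i$ denotes the simple representation of $\Delta_n^{\mathrm{op}}$ (the quiver with arrows $i+1\to i$) at the vertex $i$. The category $\mathcal{T}_n$ is a hereditary abelian category in which every indecomposable object is uniserial and determined up to isomorphism by its socle and its length. Its Grothendieck group is $G_0(\mathcal{T}_n)=\bigoplus_{i=1}^n\mathbb{Z}[S_i]\cong\mathbb{Z}^n$, and the class $[X]$ of an object $X$ corresponds to its dimension vector $\underline{\dim}\,X$. Let $\mathcal{A}$ be an abelian category. A stability function on $\mathcal{A}$ is a group homomorphism $Z:G_0(\mathcal{A})\to\mathbb{C}$ such that for each nonzero object $X$ the number $Z([X])$ is nonzero and has argument $\arg Z([X])\in[0,\pi)$; this argument is called the phase of $X$. A nonzero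 object $X$ is stable (resp. semi-stable) if every nonzero proper subobject $Y$ of $X$ satisfies $\arg Z([Y])<\arg Z([X])$ (resp. $\arg Z([Y])\le\arg Z([X])$). For $\mu\in[0,\pi)$, $\mathcal{A}_\mu$ denotes the full subcategory of $\mathcal{A}$ consisting of the zero object and the semi-stable objects of phase $\mu$; it is an abelian subcategory whose simple objects are precisely the stable objects of phase $\mu$. The stability function $Z$ is discrete if for each $\mu$ the subcategory $\mathcal{A}_\mu$ is zero or has a unique simple object up to isomorphism (equivalently, non-isomorphic stable objects have different phases). It is completely discrete if it is discrete and moreover every $\mathcal{A}_\mu$ is semisimple. *)

(* Defs.v *)
From HB Require Import structures.
From mathcomp Require Import all_boot all_order all_algebra.
From mathcomp Require Import complex.
From mathcomp Require Import reals trigo.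

Set Implicit Arguments.
Unset Strict Implicit.
Unset Printing Implicit Defensive.

Import Order.TTheory GRing.Theory Num.Theory.
Import ComplexField.Normc.

Local Open Scope ring_scope.

(* The vertices 1, ..., n are indexed here by 'I_n = {0, ..., n-1}; ordS is
   the cyclic successor, so ract X i is the map attached to the arrow
   i+1 -> i of the opposite cyclic quiver. *)
Record rep (k : fieldType) (n : nat) := Rep {
  rspace :> 'I_n -> vectType k;
  ract : forall i : 'I_n, 'Hom(rspace (ordS i), rspace i)
}.

Section Representations.
Variables (k : fieldType) (n : nat).
Implicit Types X Y S M : rep k n.

(* The action of the path of length N ending at i (it starts at i + N). *)
Fixpoint rpath X (N : nat) (i : 'I_n) : 'Hom(X (iter N (@ordS n) i), X i) :=
  match N return 'Hom(X (iter N (@ordS n) i), X i) with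
  | 0 => \1%VF
  | N'.+1 => (rpath X N' i \o ract X (iter N' (@ordS n) i))%VF
  end.

Definition nilpotent_rep X : Prop :=
  exists N : nat, forall i : 'I_n, rpath X N i = 0.

Record rep_hom X Y := RepHom {
  hmap :> forall i : 'I_n, 'Hom(X i, Y i);
  hmapP : forall i : 'I_n,
    (hmap i \o ract X i = ract Y i \o hmap (ordS i))%VF
}.

Definition rep_mono X Y (f : rep_hom X Y) : Prop :=
  forall i : 'I_n, injective (f i).

Definition rep_iso X Y (f : rep_hom X Y) : Prop :=
  forall i : 'I_n, bijective (f i).

Definition isomorphic X Y : Prop := exists f : rep_hom X Y, rep_iso f.

Definition zero_rep X : Prop := forall (i : 'I_n) (x : X i), x = 0.

Definition dim_vec X : 'rV[int]_n := \row_i (\dim {: X i})%:Z.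

(* X is the biproduct (finite direct sum) of the family S. *)
Definition is_direct_sum (m : nat) (S : 'I_m -> rep k n) X : Prop :=
  exists (inj : forall j : 'I_m, rep_hom (S j) X)
         (prj : forall j : 'I_m, rep_hom X (S j)),
    [/\ forall j i, (prj j i \o inj j i)%VF = \1%VF,
        forall j l i, j != l -> (prj l i \o inj j i)%VF = 0
      & forall i, \sum_(j < m) (inj j i \o prj j i)%VF = \1%VF].

(* In what follows a full subcategory is given by the predicate A of its
   objects.  For the subcategories considered (T_n and the semistable
   subcategories) the inclusion is exact, so that the subobjects of X in A are
   the injective morphisms Y -> X with Y in A. *)
Definition zero_cat (A : rep k n -> Prop) : Prop := forall X, A X -> zero_rep X.

Definition simple_obj (A : rep k n -> Prop) S : Prop :=
  [/\ A S, ~ zero_rep S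
    & forall Y (f : rep_hom Y S),
        A Y -> rep_mono f -> zero_rep Y \/ rep_iso f].

Definition unique_simple (A : rep k n -> Prop) S : Prop :=
  simple_obj A S /\ forall S', simple_obj A S' -> isomorphic S' S.

Definition semisimple_cat (A : rep k n -> Prop) : Prop :=
  forall X, A X ->
    exists (m : nat) (S : 'I_m -> rep k n),
      (forall j, simple_obj A (S j)) /\ is_direct_sum S X.

End Representations.

(* The principal argument, with values in ]-pi, pi]. *)
Definition arg (R : realType) (z : R[i]) : R :=
  let t := acos (complex.Re z / normc z) in
  if 0 <= complex.Im z then t else - t.

Lemma arg_polar (R : realType) (z : R[i]) : z != 0 ->
  complex.Re z = normc z * cos (arg z) /\
  complex.Im z = normc z * sin (arg z).
Proof.
case: z => a b z0; rewrite /arg /=.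
set r := Num.sqrt _.
have r2 : r ^+ 2 = a ^+ 2 + b ^+ 2 by rewrite sqr_sqrtr ?addr_ge0 ?sqr_ge0.
have r0 : 0 < r.
  rewrite lt_def sqrtr_ge0 andbT; apply: contra z0 => /eqP rE.
  by apply/eqP; apply: eq0_normc.
have rn0 : r != 0 by rewrite gt_eqF.
have ar : -1 <= a / r <= 1.
  rewrite -ler_norml normrM normfV (gtr0_norm r0) ler_pdivrMr // mul1r.
  by rewrite -sqrtr_sqr ler_wsqrtr // lerDl sqr_ge0.
have cE : cos (if 0 <= b then acos (a / r) else - acos (a / r)) = a / r.
  by case: ifP => _; rewrite ?cosN acosK.
have sE : sin (acos (a / r)) = `|b| / r.
  rewrite sin_acos // expr_div_n -[1](@divff _ (r ^+ 2)) ?expf_neq0 //.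
  rewrite -mulrBl r2 addrAC subrr add0r -r2 -expr_div_n sqrtr_sqr.
  by rewrite normrM normfV (gtr0_norm r0).
split; first by rewrite cE mulrCA divff ?mulr1.
case: (ltrP b 0) => b0; rewrite ?sinN sE.
  by rewrite (ltr0_norm b0) -mulNr opprK mulrCA divff ?mulr1.
by rewrite (ger0_norm b0) mulrCA divff ?mulr1.
Qed.

Lemma arg_range (R : realType) (z : R[i]) : z != 0 -> - pi < arg z <= pi.
Proof.
case: z => a b z0; rewrite /arg /=.
set r := Num.sqrt _.
have r0 : 0 < r.
  rewrite lt_def sqrtr_ge0 andbT; apply: contra z0 => /eqP rE.
  by apply/eqP; apply: eq0_normc.
have ar : `|a / r| <= 1.
  rewrite normrM normfV (gtr0_norm r0) ler_pdivrMr // mul1r.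
  by rewrite -sqrtr_sqr ler_wsqrtr // lerDl sqr_ge0.
have pi0 := pi_gt0 R.
case: (ltrP b 0) => b0; last first.
  rewrite acos_lepi -?ler_norml // andbT (lt_le_trans _ (acos_ge0 _)) -?ler_norml //.
  by rewrite oppr_lt0.
have ar1 : `|a / r| < 1.
  rewrite normrM normfV (gtr0_norm r0) ltr_pdivrMr // mul1r.
  have b2 : 0 < b ^+ 2 by rewrite exprn_even_gt0 //= lt_eqF.
  by rewrite -sqrtr_sqr ltr_sqrt ?ltrDl // ltr_wpDl ?sqr_ge0.
rewrite ltrN2; move: ar1; rewrite ltr_norml => /andP[l1 l2].
apply/andP; split; first by rewrite acos_ltpi // l1 ltW.
by rewrite (le_trans _ (ltW pi0)) // oppr_le0 acos_ge0 // !ltW.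
Qed.

Section Stability.
Variables (k : fieldType) (n : nat) (R : realType).

(* The Grothendieck group of T_n is identified with Z^n through dimension
   vectors, the class of X being dim_vec X. *)
Variable Z : {additive 'rV[int]_n -> R[i]}.
Implicit Types X Y : rep k n.

Definition phase X : R := arg (Z (dim_vec X)).

Definition stability_function : Prop :=
  forall X, nilpotent_rep X -> ~ zero_rep X ->
    Z (dim_vec X) != 0 /\ 0 <= phase X < pi.

Definition stable_rep X : Prop :=
  [/\ nilpotent_rep X, ~ zero_rep X
    & forall Y (f : rep_hom Y X),
        nilpotent_rep Y -> ~ zero_rep Y -> rep_mono f -> ~ rep_iso f ->
        phase Y < phase X].

Definition semistable_rep X : Prop :=
  [/\ nilpotent_rep X, ~ zero_rep X
    & forall Y (f : rep_hom Y X),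
        nilpotent_rep Y -> ~ zero_rep Y -> rep_mono f -> ~ rep_iso f ->
        phase Y <= phase X].

Definition semistable_cat (mu : R) X : Prop :=
  zero_rep X \/ (semistable_rep X /\ phase X = mu).

Definition discrete_stability : Prop :=
  forall mu : R, 0 <= mu < pi ->
    zero_cat (semistable_cat mu) \/
    exists S : rep k n, unique_simple (semistable_cat mu) S.

Definition completely_discrete_stability : Prop :=
  discrete_stability /\
  forall mu : R, 0 <= mu < pi -> semisimple_cat (semistable_cat mu).

End Stability.

Arguments stability_function k {n R} Z.
Arguments semistable_cat k {n R} Z mu X.
Arguments discrete_stability k {n R} Z.
Arguments completely_discrete_stability k {n R} Z.

(* Main.v *)
Require Import Defs.
From HB Require Import structures.
From mathcomp Require Import all_boot all_order all_algebra.
From mathcomp Require Import complex.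
From mathcomp Require Import reals trigo.
From mathcomp Require Import zify ring.

Set Implicit Arguments.
Unset Strict Implicit.
Unset Printing Implicit Defensive.

Import Order.TTheory GRing.Theory Num.Theory.

Local Open Scope ring_scope.

(* For h = Z(delta), the sign of the cross product of h and Z([Y]) compares the
   phase of Y with arg h, and it is additive in [Y]; its sums along the cycle
   are periodic since it vanishes on delta.  Starting the cycle at a maximum of
   the partial sums makes all initial segments nonpositive, so the uniserial
   object of dimension vector delta starting there is semistable; two distinct
   maxima would give two stable objects of the same phase with different
   socles, against discreteness, so it is stable.  Doubling its length gives a
   nonsplit self-extension.  Conversely, every nilpotent representation is a
   direct sum of uniserial ones; the summands of a semistable object of another
   phase have length less than n, since the segments of length n have slope 0
   only for the phase of delta, and the same minimality argument shows that
   they are stable. *)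

(** * Segments of the cycle and their classes *)

Section CyclicIndex.
Variable n : nat.
Implicit Types i j : 'I_n.

Lemma val_iter_ordS t i : iter t (@ordS n) i = ((i + t) %% n)%N :> nat.
Proof.
elim: t => [|t IH]; first by rewrite addn0 modn_small.
by rewrite iterS /= IH -addn1 modnDml addn1 addnS.
Qed.

Lemma iter_ordS_n i : iter n (@ordS n) i = i.
Proof. by apply: val_inj; rewrite /= val_iter_ordS modnDr modn_small. Qed.

Lemma iter_ordS_neq t i : (0 < t < n)%N -> iter t (@ordS n) i != i.
Proof.
move=> /andP[t0 tn]; apply/eqP => /(congr1 (@nat_of_ord n)).
rewrite val_iter_ordS; have := ltn_ord i => ilt.
case: (ltnP (i + t) n) => h; first by rewrite modn_small //; lia.
by rewrite -(subnK h) modnDr modn_small; lia.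
Qed.

(** The class of the uniserial object of socle [i] and length [l], whose composition factors sit at
    i, i+1, ..., i+l-1. *)
Definition interval_vec (i : 'I_n) (l : nat) : 'rV[int]_n :=
  \sum_(t < l) delta_mx 0 (iter t (@ordS n) i).

Lemma interval_vecD i s t :
  interval_vec i (s + t) = interval_vec i s + interval_vec (iter s (@ordS n) i) t.
Proof.
rewrite /interval_vec big_split_ord /=; congr (_ + _).
by apply: eq_bigr => u _; rewrite -iterD addnC.
Qed.

Lemma interval_vecE i l j :
  interval_vec i l 0 j = #|[pred t : 'I_l | iter t (@ordS n) i == j]|%:Z.
Proof.
rewrite /interval_vec summxE -sum1_card -natz natr_sum.
rewrite [RHS]big_mkcond; apply: eq_bigr => t _.
by rewrite mxE inE eq_sym /=; case: eqP.
Qed.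

Lemma interval_vec_n i : interval_vec i n = const_mx 1.
Proof.
apply/rowP => j; rewrite interval_vecE mxE; congr (_%:Z).
have n0 : (0 < n)%N by apply: leq_ltn_trans (ltn_ord i).
(* One turn meets [j] exactly once, after j - i steps modulo [n]; writing this as [j + (n - i)]
   avoids truncated subtraction. *)
rewrite (eq_card1 (x := Ordinal (ltn_pmod (j + (n - i)) n0))) // => t.
rewrite !inE -!val_eqE /= val_iter_ordS.
have := ltn_ord i; have := ltn_ord j; have := ltn_ord t.
move: {t}(nat_of_ord t) {i}(nat_of_ord i) {j}(nat_of_ord j) => t i j tn jn iN.
have e a : (a < n + n)%N -> (a %% n)%N = if (a < n)%N then a else (a - n)%N.
  case: (ltnP a n) => [/modn_small //|h1 h2].
  by rewrite -[X in (X %% _)%N](subnK h1) modnDr modn_small //; lia.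
rewrite !e; [|lia|lia].
by apply/eqP/eqP; case: ltnP => h1; case: ltnP => h2; lia.
Qed.

End CyclicIndex.

(** * Morphisms of representations and actions of paths *)

Section Morphisms.
Variables (k : fieldType) (n : nat).
Implicit Types X Y W : rep k n.

Lemma hmapE X Y (f : rep_hom X Y) i x :
  f i (ract X i x) = ract Y i (f (ordS i) x).
Proof. by rewrite -!comp_lfunE hmapP. Qed.

Definition rep_id X : rep_hom X X :=
  @RepHom k n X X (fun i => \1%VF)
    (fun i => etrans (comp_lfun1l _) (esym (comp_lfun1r _))).

Lemma comp_hmapP X Y W (g : rep_hom Y W) (f : rep_hom X Y) i :
  ((g i \o f i) \o ract X i = ract W i \o (g (ordS i) \o f (ordS i)))%VF.
Proof. by rewrite -comp_lfunA hmapP !comp_lfunA hmapP. Qed.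

Definition rep_comp X Y W (g : rep_hom Y W) (f : rep_hom X Y) : rep_hom X W :=
  RepHom (comp_hmapP g f).

Lemma rep_compE X Y W (g : rep_hom Y W) (f : rep_hom X Y) i x :
  rep_comp g f i x = g i (f i x).
Proof. exact: comp_lfunE. Qed.

Lemma sub_hmapP X Y (f g : rep_hom X Y) i :
  ((f i - g i) \o ract X i = ract Y i \o (f (ordS i) - g (ordS i)))%VF.
Proof. by rewrite comp_lfunDl comp_lfunDr comp_lfunNl comp_lfunNr !hmapP. Qed.

Definition rep_sub X Y (f g : rep_hom X Y) : rep_hom X Y :=
  RepHom (sub_hmapP f g).

Lemma rep_subE X Y (f g : rep_hom X Y) i x :
  rep_sub f g i x = f i x - g i x.
Proof. by rewrite /= add_lfunE opp_lfunE. Qed.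

Lemma mono_eq0 X Y (f : rep_hom X Y) i x :
  rep_mono f -> f i x = 0 -> x = 0.
Proof. by move=> fm fx; apply: (fm i); rewrite linear0. Qed.

Lemma rep_monoP X Y (f : rep_hom X Y) :
  (forall i x, f i x = 0 -> x = 0) -> rep_mono f.
Proof.
move=> f0 i; apply/lker0P; rewrite -subv0; apply/subvP => x.
by rewrite memv_ker memv0 => /eqP /f0 ->.
Qed.

Lemma mono_comp X Y W (g : rep_hom Y W) (f : rep_hom X Y) :
  rep_mono g -> rep_mono f -> rep_mono (rep_comp g f).
Proof.
move=> gm fm; apply: rep_monoP => i x.
by rewrite rep_compE => /(mono_eq0 gm) /(mono_eq0 fm).
Qed.

Lemma mono_dim X Y (f : rep_hom X Y) i :
  rep_mono f -> (\dim {: X i} <= \dim {: Y i})%N.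
Proof.
move=> fm; have /lker0P /eqP ker0 := fm i.
by rewrite -(@limg_dim_eq _ _ _ (f i)) ?dimvS ?subvf // ker0 capv0.
Qed.

Lemma mono_iso X Y (f : rep_hom X Y) :
  rep_mono f -> (forall i, \dim {: X i} = \dim {: Y i}) -> rep_iso f.
Proof.
move=> fm fd i; have /lker0P ker0 := fm i.
have full : limg (f i) = fullv.
  apply/eqP; rewrite eqEdim subvf /= limg_dim_eq ?fd //.
  by rewrite (eqP ker0) capv0.
exists (f i)^-1%VF; first exact: lker0_lfunK.
by move=> y; rewrite limg_lfunVK // full memvf.
Qed.

Lemma iso_mono X Y (f : rep_hom X Y) : rep_iso f -> rep_mono f.
Proof. by move=> fi i; apply: bij_inj. Qed.

Lemma rep_iso_inv X Y (f : rep_hom X Y) : rep_iso f ->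
  exists g : rep_hom Y X,
    (forall i x, g i (f i x) = x) /\ (forall i y, f i (g i y) = y).
Proof.
move=> fi; have fm := iso_mono fi.
have gf i : cancel (f i) (f i)^-1%VF by apply: lker0_lfunK; apply/lker0P.
have fg i : cancel (f i)^-1%VF (f i).
  by move=> y; have [h _ hK] := fi i; rewrite -(hK y) gf.
have gP i : ((f i)^-1 \o ract Y i = ract X i \o (f (ordS i))^-1)%VF.
  by apply/lfunP => y; apply: (fm i); rewrite !comp_lfunE hmapE !fg.
by exists (RepHom gP).
Qed.

Lemma iso_dim X Y i : isomorphic X Y -> \dim {: X i} = \dim {: Y i}.
Proof.
move=> [f fi]; have [g [gf fg]] := rep_iso_inv fi.
apply/eqP; rewrite eqn_leq (mono_dim i (iso_mono fi)) (mono_dim (f := g)) //.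
by apply: rep_monoP => j x gx; rewrite -(fg j x) gx linear0.
Qed.

Lemma iso_sym X Y : isomorphic X Y -> isomorphic Y X.
Proof.
move=> [f fi]; have [g [gf fg]] := rep_iso_inv fi.
by exists g => i; exists (f i).
Qed.

Lemma iso_trans X Y W : isomorphic X Y -> isomorphic Y W -> isomorphic X W.
Proof.
move=> [f fi] [g gi]; exists (rep_comp g f) => i.
by apply: (eq_bij (bij_comp (gi i) (fi i))) => x; rewrite rep_compE.
Qed.

Lemma dim_vec_eq X Y :
  dim_vec X = dim_vec Y <-> forall i, \dim {: X i} = \dim {: Y i}.
Proof.
split=> [/rowP e i|e]; last by apply/rowP => i; rewrite !mxE e.
by have := e i; rewrite !mxE => -[].
Qed.

(** The path of length 0 is transported along a proof of [j = i], and is 0 if there is none; a path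
    that closes up on the cycle then needs no cast in [gpath]. *)
Definition vertex_id X (j i : 'I_n) : 'Hom(X j, X i) :=
  match @eqP _ j i with
  | ReflectT e => eq_rect j (fun i => 'Hom(X j, X i)) \1%VF i e
  | ReflectF _ => 0
  end.

Lemma vertex_id1 X i : vertex_id X i i = \1%VF.
Proof.
rewrite /vertex_id; case: eqP => // e.
by rewrite (eq_irrelevance e (erefl i)).
Qed.

Lemma vertex_id0 X j i : j != i -> vertex_id X j i = 0.
Proof. by rewrite /vertex_id; case: eqP. Qed.

(* The action of the path of length t from j to i, which is 0 when there is no
   such path: unlike [rpath], both endpoints are free indices. *)
Fixpoint gpath X (t : nat) (j i : 'I_n) : 'Hom(X j, X i) :=
  if t is s.+1 then (ract X i \o gpath X s j (ordS i))%VF else vertex_id X j i.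

Lemma gpathS X t j i x :
  gpath X t.+1 j i x = ract X i (gpath X t j (ordS i) x).
Proof. exact: comp_lfunE. Qed.

(** [gpath] peels off the last arrow of a path, this lemma the first; injectivity of [ordS] makes
    the zero cases agree. *)
Lemma gpathSr X t j i :
  gpath X t.+1 (ordS j) i = (gpath X t j i \o ract X j)%VF.
Proof.
elim: t i => [|t IH] i /=; last by rewrite -comp_lfunA -IH.
have [<-|ji] := eqVneq j i; first by rewrite !vertex_id1 comp_lfun1l comp_lfun1r.
by rewrite !vertex_id0 ?comp_lfun0l ?comp_lfun0r // (inj_eq (@ordS_inj n)).
Qed.

Lemma gpathSrE X t j i x :
  gpath X t.+1 (ordS j) i x = gpath X t j i (ract X j x).
Proof. by rewrite gpathSr comp_lfunE. Qed.

Lemma gpath_rpath X t i : gpath X t (iter t (@ordS n) i) i = rpath X t i.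
Proof.
elim: t => [|t IH]; first exact: vertex_id1.
by rewrite [LHS]gpathSr IH.
Qed.

Lemma gpath0 X t j i : iter t (@ordS n) i != j -> gpath X t j i = 0.
Proof.
elim: t i => [|t IH] i /= h; first by rewrite vertex_id0 // eq_sym.
by rewrite IH ?comp_lfun0r // -iterSr.
Qed.

Lemma gpath_hom X Y (f : rep_hom X Y) t j i x :
  f i (gpath X t j i x) = gpath Y t j i (f j x).
Proof.
elim: t i => [|t IH] i; last by rewrite !gpathS hmapE IH.
rewrite /=; have [<-|ji] := eqVneq j i; first by rewrite !vertex_id1 !id_lfunE.
by rewrite !vertex_id0 // !zero_lfunE linear0.
Qed.

Lemma nilpotentP X :
  nilpotent_rep X <-> exists N, forall j i, gpath X N j i = 0.
Proof.
split=> -[N hN]; exists N; last by move=> i; rewrite -gpath_rpath hN.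
move=> j i; have [<-|/gpath0->//] := eqVneq (iter N (@ordS n) i) j.
by rewrite gpath_rpath hN.
Qed.

Lemma nilpotent_sub X Y (f : rep_hom Y X) :
  rep_mono f -> nilpotent_rep X -> nilpotent_rep Y.
Proof.
move=> fm /nilpotentP[N hN]; apply/nilpotentP; exists N => j i.
by apply/lfunP => x; apply: (fm i); rewrite gpath_hom hN !zero_lfunE linear0.
Qed.

Lemma gpath_ge X s t j i x : (s <= t)%N ->
  (forall i, gpath X s j i x = 0) -> gpath X t j i x = 0.
Proof.
move=> /subnK <- s0; elim: (t - s)%N i => [|d IH] i; first exact: s0.
by rewrite addSn gpathS IH linear0.
Qed.

Lemma longest_path X (e : rep_hom X X) :
  nilpotent_rep X -> ~ (forall i x, e i x = 0) ->
  exists (N : nat) (j i : 'I_n) (x : X j),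
    (forall j i x, gpath X N.+1 j i (e j x) = 0) /\ gpath X N j i (e j x) <> 0.
Proof.
move=> /nilpotentP nilX e0.
pose P N := [forall j, forall i, (gpath X N j i \o e j == 0)%VF].
have PP N : reflect (forall j i x, gpath X N j i (e j x) = 0) (P N).
  apply: (iffP forallP) => [h j i x|h j].
    by have /forallP/(_ i)/eqP hh := h j; rewrite -comp_lfunE hh zero_lfunE.
  apply/forallP => i; apply/eqP/lfunP => x.
  by rewrite comp_lfunE zero_lfunE.
have exP : exists N, P N.
  by case: nilX => N hN; exists N; apply/PP => j i x; rewrite hN zero_lfunE.
(* The least length at which all paths kill the image of [e] is positive because [e] is nonzero; its
   predecessor is the [N] sought. *)
case: (ex_minnP exP) => -[|N] /PP PN minN.
  by case: e0 => i x; have := PN i i x; rewrite /= vertex_id1 id_lfunE.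
have : ~~ P N by apply/negP => /minN; rewrite ltnn.
case/forallPn => j hj.
have [i /lfunPn[x]] : exists i, (gpath X N j i \o e j)%VF != 0 by apply/forallPn.
rewrite comp_lfunE zero_lfunE => /eqP hx.
by exists N, j, i, x.
Qed.

End Morphisms.

(** * Uniserial representations, maps from and to them, and their subobjects *)

Section Uniserial.
Variables (k : fieldType) (n : nat).
Implicit Types X Y : rep k n.

(** The linear structure is packed on the spot, so that maps introduced inside a proof need no
    global instance. *)
Definition lfun_of (V W : vectType k) (f : V -> W) (fl : linear f) : 'Hom(V, W) :=
  let H := GRing.isLinear.Build k V W *:%R f fl in
  linfun (HB.pack_for {linear V -> W} f H).

Lemma lfun_ofE (V W : vectType k) (f : V -> W) (fl : linear f) x :
  lfun_of fl x = f x.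
Proof. exact: lfunE. Qed.

(* The indecomposable of socle S_i and length l has a basis e_0, ..., e_(l-1)
   with e_t at the vertex i + t, and the arrows send e_(t+1) to e_t and e_0
   to 0.  A vector at the vertex j is recorded by its coordinates on the e_t
   living at j; [coef] extends them by 0 to all t. *)
Definition uspace (i : 'I_n) (l : nat) (j : 'I_n) : vectType k :=
  {ffun {t : 'I_l | iter t (@ordS n) i == j} -> k^o}.

Section Coefficients.
Variables (i : 'I_n) (l : nat).
Implicit Types j : 'I_n.

Definition coef j (t : nat) (g : uspace i l j) : k^o :=
  if insub t is Some u then
    if insub (u : 'I_l) is Some v then g v else 0
  else 0.
Arguments coef {j} t g.

Definition of_coef j (F : nat -> k) : uspace i l j :=
  [ffun v => F (val (val v))].

Lemma coef_val j (g : uspace i l j) v : coef (val (val v)) g = g v.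
Proof. by rewrite /coef !valK. Qed.

Lemma coef_of_coef j F t :
  coef t (of_coef j F) =
  if (t < l)%N && (iter t (@ordS n) i == j) then F t else 0.
Proof.
rewrite /coef; case: insubP => [u tl ut|/negbTE->//].
rewrite tl; case: insubP => [v uj vu|/negbTE]; rewrite -ut /=.
  by rewrite uj ffunE vu.
by move=> ->.
Qed.

Lemma coef_inj j (g h : uspace i l j) :
  (forall t, coef t g = coef t h) -> g = h.
Proof. by move=> e; apply/ffunP => v; rewrite -!coef_val e. Qed.

Lemma coefK j (g : uspace i l j) : of_coef j (coef ^~ g) = g.
Proof. by apply/ffunP => v; rewrite ffunE coef_val. Qed.

Lemma coef_eq0 j (g : uspace i l j) t :
  ~~ ((t < l)%N && (iter t (@ordS n) i == j)) -> coef t g = 0.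
Proof. by move=> /negbTE h; rewrite -(coefK g) coef_of_coef h. Qed.

Lemma coef_linear j t : linear (@coef j t).
Proof.
move=> a g h; rewrite /coef; case: insubP => [u _ _|_]; last first.
  by rewrite scaler0 addr0.
by case: insubP => [v _ _|_]; rewrite ?ffunE // scaler0 addr0.
Qed.

HB.instance Definition _ j t :=
  GRing.isLinear.Build k (uspace i l j) k^o *:%R
    (@coef j t) (@coef_linear j t).

Lemma coef0 j t : coef t (0 : uspace i l j) = 0.
Proof. exact: linear0. Qed.

Lemma of_coef_linear j (V : vectType k) (F : V -> nat -> k) :
  (forall t, linear (fun x => F x t : k^o)) ->
  linear (fun x => of_coef j (F x)).
Proof. by move=> Fl a x y; apply/ffunP => v; rewrite !ffunE Fl. Qed.

Definition lfun_of_coef j (V : vectType k) (F : V -> nat -> k)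
    (Fl : forall t, linear (fun x => F x t : k^o)) : 'Hom(V, uspace i l j) :=
  lfun_of (of_coef_linear j Fl).

Lemma lfun_of_coefE j V F Fl x t :
  coef t (@lfun_of_coef j V F Fl x) =
  if (t < l)%N && (iter t (@ordS n) i == j) then F x t else 0.
Proof. by rewrite lfun_ofE coef_of_coef. Qed.

Definition uact j : 'Hom(uspace i l (ordS j), uspace i l j) :=
  @lfun_of_coef j _ (fun g t => coef t.+1 g)
    (fun t => @coef_linear (ordS j) t.+1).

Definition uniserial : rep k n := @Rep k n (uspace i l) uact.

Lemma coef_ract j (g : uniserial (ordS j)) t :
  coef t (ract uniserial j g) = coef t.+1 g.
Proof.
rewrite lfun_of_coefE; case: ifP => // /negbT h; apply/esym/coef_eq0.
by apply: contra h => /andP[/ltnW -> /eqP/ordS_inj/eqP].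
Qed.

(** A path of length t shifts coordinates by t. The hypothesis says that e_s lives at [j'];
    otherwise the left side is 0 whatever [g] is. *)
Lemma coef_gpath t j j' (g : uniserial j) s :
  iter s (@ordS n) i = j' -> coef s (gpath uniserial t j j' g) = coef (s + t) g.
Proof.
elim: t j' s => [|t IH] j' s sj'.
  rewrite addn0 /=; have [<-|ne] := eqVneq j j'; first by rewrite vertex_id1 id_lfunE.
  rewrite vertex_id0 // zero_lfunE coef0 coef_eq0 // negb_and sj'.
  by rewrite eq_sym ne orbT.
by rewrite gpathS coef_ract IH ?addnS //= sj'.
Qed.

Lemma gpath_uniserial j j' g : gpath uniserial l j j' g = 0.
Proof.
apply: coef_inj => s; rewrite coef0.
have [sj|sj] := eqVneq (iter s (@ordS n) i) j'; last first.
  by rewrite coef_eq0 // negb_and sj orbT.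
by rewrite coef_gpath // coef_eq0 // negb_and -leqNgt leq_addl.
Qed.

Lemma uniserial_nilpotent : nilpotent_rep uniserial.
Proof.
apply/nilpotentP; exists l => j j'; apply/lfunP => g.
by rewrite gpath_uniserial zero_lfunE.
Qed.

Lemma uniserial_dim j : \dim {: uniserial j} =
  #|[pred t : 'I_l | iter t (@ordS n) i == j]|.
Proof. by rewrite dimvf /dim /= muln1 card_sig. Qed.

Lemma uniserial_dim_vec : dim_vec uniserial = interval_vec i l.
Proof. by apply/rowP => j; rewrite mxE interval_vecE uniserial_dim. Qed.

Definition socle_gen : uniserial i := of_coef i (fun t => (t == 0)%:R).

Lemma socle_genP (g : uniserial i) :
  (forall t, coef t.+1 g = 0) -> g = coef 0 g *: socle_gen.
Proof.
move=> g0; apply: coef_inj => t; rewrite linearZ.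
rewrite /= coef_of_coef; case: t => [|t]; last by rewrite g0 if_same scaler0.
rewrite eqxx andbT; case: ifP => h; first by rewrite [RHS]mulr1.
by rewrite scaler0 coef_eq0 // h.
Qed.

Lemma socle_gen_neq0 : (0 < l)%N -> socle_gen <> 0.
Proof.
move=> l0 /(congr1 (fun g => coef 0 g)); rewrite coef0 coef_of_coef l0 eqxx.
by move/eqP; rewrite oner_eq0.
Qed.

Lemma uniserial_neq0 : (0 < l)%N -> ~ zero_rep uniserial.
Proof. by move=> /socle_gen_neq0 h /(_ i socle_gen). Qed.

(* Every nonzero element has a multiple in the socle. *)
Lemma uniserial_mono X (f : rep_hom uniserial X) :
  f i socle_gen <> 0 -> rep_mono f.
Proof.
move=> fs; apply: rep_monoP => j g fg; apply: coef_inj.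
(* Descending induction on [t]: a path of length [t] moves coordinate [t] to the socle, where the
   higher coordinates already vanish. *)
suff h m t : (l <= m + t)%N -> coef t g = 0.
  by move=> t; rewrite coef0 (h l) ?leq_addr.
elim: m t => [|m IH] t; first by move=> h; rewrite coef_eq0 // negb_and -leqNgt h.
move=> lt; have [tj|tj] := eqVneq (iter t (@ordS n) i) j; last first.
  by rewrite coef_eq0 // negb_and tj orbT.
pose w := gpath uniserial t j i g.
have ws : w = coef t g *: socle_gen.
  rewrite -[t in coef t g]add0n -(coef_gpath t (j' := i)) //.
  apply: socle_genP => s.
  have [si|si] := eqVneq (iter s.+1 (@ordS n) i) i.
    by rewrite coef_gpath // IH //; lia.
  by rewrite coef_eq0 // negb_and si orbT.
have : f i w = 0 by rewrite gpath_hom fg linear0.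
rewrite ws linearZ => /eqP; rewrite scaler_eq0 => /orP[/eqP->//|/eqP //].
Qed.

End Coefficients.

Arguments coef {i l j} t g.

Lemma rep_of_gen_subproof X i N j0 (x : X j0) j :
  linear (fun g : uspace i N.+1 j =>
    \sum_(t < N.+1) coef t g *: gpath X (N - t) j0 j x).
Proof.
move=> a g h; rewrite scaler_sumr -big_split; apply: eq_bigr => t _ /=.
rewrite linearP /=.
by rewrite scalerDl scalerA.
Qed.

(** The top basis vector e_N is sent to [x], hence e_t to the path of length N - t applied to [x].
    If [j0] is not i + N, all these images are 0. *)
Lemma rep_of_gen X i N j0 (x : X j0) :
  (forall j, gpath X N.+1 j0 j x = 0) ->
  exists f : rep_hom (uniserial i N.+1) X,
    f i (socle_gen i N.+1) = gpath X N j0 i x.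
Proof.
move=> x0.
pose h j : 'Hom(uniserial i N.+1 j, X j) :=
  lfun_of (fun a => @rep_of_gen_subproof X i N j0 x j a).
have hE j g : h j g = \sum_(t < N.+1) coef t g *: gpath X (N - t) j0 j x.
  exact: lfun_ofE.
have hP j : (h j \o ract (uniserial i N.+1) j = ract X j \o h (ordS j))%VF.
  apply/lfunP => g; rewrite !comp_lfunE !hE linear_sum.
  (* The two sums differ by a shift of index. The extra last term on the left has a coordinate
     beyond the length, the extra first term on the right a path of length N + 1 applied to [x];
     both vanish. *)
  rewrite big_ord_recr [RHS]big_ord_recl /= subn0 linearZ /= -gpathS x0 scaler0 add0r.
  rewrite coef_ract coef_eq0 ?ltnn // scale0r addr0.
  apply: eq_bigr => t _; rewrite coef_ract linearZ /= /bump /= add1n.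
  by rewrite -gpathS subnSK.
exists (RepHom hP); rewrite /= hE big_ord_recl /= subn0 coef_of_coef /= !eqxx scale1r.
rewrite big1 ?addr0 // => t _; rewrite coef_of_coef /=.
by rewrite if_same scale0r.
Qed.

(** Dual to [rep_of_gen]: a map into a uniserial object is determined by its socle coordinate,
    because coordinate t is the socle coordinate after a path of length t. *)
Lemma rep_of_functional X Y (e : rep_hom X Y) i l (phi : {linear Y i -> k^o}) :
  (forall j x, phi (gpath Y l j i (e j x)) = 0) ->
  exists f : rep_hom X (uniserial i l), forall j x t,
    coef t (f j x) =
    if (t < l)%N && (iter t (@ordS n) i == j) then phi (gpath Y t j i (e j x)) else 0.
Proof.
move=> phi0.
have lin j t : linear (fun x : X j => phi (gpath Y t j i (e j x)) : k^o).
  by move=> a x y; rewrite !linearP.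
pose h j : 'Hom(X j, uniserial i l j) := lfun_of_coef i l j (lin j).
have hP j : (h j \o ract X j = ract (uniserial i l) j \o h (ordS j))%VF.
  apply/lfunP => x; rewrite !comp_lfunE; apply: coef_inj => t.
  rewrite coef_ract !lfun_of_coefE hmapE -gpathSrE /= (inj_eq (@ordS_inj n)).
  case: (iter t _ i =P j) => _; rewrite ?andbF // !andbT.
  (* Only t + 1 = l is delicate: the right side is cut off there, and [phi0] makes the left side
     vanish too. *)
  case: (ltngtP t.+1 l) => [tl|tl|tl]; rewrite ?(ltnW tl) //.
  by move: phi0; rewrite -tl => ->.
by exists (RepHom hP) => j x t; rewrite lfun_of_coefE.
Qed.

Lemma uniserial_incl i s l : (s <= l)%N ->
  exists f : rep_hom (uniserial i s) (uniserial i l), rep_mono f.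
Proof.
move=> sl.
pose phi : {linear uspace i s i -> k^o} := coef 0.
(* Reading the socle coordinate gives the map that preserves all coordinates below [s]. *)
have [j x|f fE] := @rep_of_functional _ _ (rep_id (uniserial i s)) i l phi.
  rewrite /phi /= coef_gpath // coef_eq0 //.
  by rewrite negb_and -leqNgt add0n sl.
exists f; apply: rep_monoP => j x fx; apply: coef_inj => t; rewrite coef0.
case h: ((t < s)%N && (iter t (@ordS n) i == j)); last by rewrite coef_eq0 ?h.
case/andP: h => ts /eqP tj.
have := fE j x t; rewrite fx coef0 tj eqxx (leq_trans ts sl) /= id_lfunE.
by rewrite coef_gpath // add0n.
Qed.

(** If N is the length of the longest path acting nontrivially on [Y], the uniserial object of
    length N + 1 embeds into [Y] by a generator, and [Y] embeds into it by the socle coordinate; so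
    the dimensions agree. *)
Lemma uniserial_sub Y i l (f : rep_hom Y (uniserial i l)) :
  rep_mono f -> ~ zero_rep Y ->
  exists s, (0 < s <= l)%N /\ dim_vec Y = interval_vec i s.
Proof.
move=> fm Y0.
have nilY := nilpotent_sub fm (uniserial_nilpotent i l).
have [|N [j0 [i0 [y [yN]]]]] := @longest_path _ _ _ (rep_id Y) nilY.
  by move=> h; apply: Y0 => j x; have := h j x; rewrite /= id_lfunE.
rewrite /= id_lfunE; set w := gpath _ _ _ _ _ => w0.
have {}yN j j' x : gpath Y N.+1 j j' x = 0.
  by have := yN j j' x; rewrite /= id_lfunE.
have Nl : (N < l)%N.
  rewrite ltnNge; apply/negP => lN; apply: w0; apply: (mono_eq0 fm (i := i0)).
  rewrite gpath_hom; apply: coef_inj => t; rewrite coef0.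
  have [ti|ti] := eqVneq (iter t (@ordS n) i) i0; last first.
    by rewrite coef_eq0 // negb_and ti orbT.
  by rewrite coef_gpath // coef_eq0 // negb_and -leqNgt; apply/orP; left; lia.
(* All arrows kill [w], so [f] maps it to a multiple of e_0; being nonzero, it must live at the
   socle vertex. *)
have fw t : coef t.+1 (f i0 w) = 0.
  have [ti|ti] := eqVneq (iter t.+1 (@ordS n) i) i0; last first.
    by rewrite coef_eq0 // negb_and ti orbT.
  by rewrite /w -ti -coef_ract -hmapE -gpathS yN linear0 coef0.
have i0E : i0 = i.
  apply/eqP; apply/negP => /negP ne; apply: w0; apply: (mono_eq0 fm (i := i0)).
  apply: coef_inj => -[|t]; rewrite ?fw coef0 //.
  by rewrite coef_eq0 // negb_and /= (eq_sym i) ne orbT.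
subst i0; exists N.+1; split=> //.
have [g gs] := rep_of_gen i (yN j0 ^~ y).
have gm : rep_mono g by apply: uniserial_mono; rewrite gs.
pose phi : {linear uspace i l i -> k^o} := coef 0.
have [j x|h hE] := @rep_of_functional _ _ f i N.+1 phi.
  change (coef 0 (gpath (uniserial i l) N.+1 j i (f j x)) = 0).
  by rewrite -gpath_hom yN linear0 coef0.
have hm : rep_mono h.
  apply: rep_monoP => j x hx; apply: (mono_eq0 fm (i := j)); apply: coef_inj => t.
  rewrite coef0; have [tj|tj] := eqVneq (iter t (@ordS n) i) j; last first.
    by rewrite coef_eq0 // negb_and tj orbT.
  have fxE : coef t (f j x) = coef 0 (gpath (uniserial i l) t j i (f j x)).
    by rewrite coef_gpath.
  have := hE j x t; rewrite hx coef0 tj eqxx andbT /phi /= -fxE; case: ltnP => //.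
  move=> Nt _; rewrite fxE -gpath_hom (gpath_ge i Nt) => [|i']; last exact: yN.
  by rewrite linear0 coef0.
rewrite -uniserial_dim_vec; apply/dim_vec_eq => j; apply/eqP.
by rewrite eqn_leq (mono_dim j hm) (mono_dim j gm).
Qed.

End Uniserial.

(** * Nilpotent representations as direct sums of uniserial ones *)

Section Decomposition.
Variables (k : fieldType) (n : nat).
Implicit Types X Y : rep k n.

Lemma exists_functional (V : vectType k) (v : V) : v <> 0 ->
  exists phi : {linear V -> k^o}, phi v <> 0.
Proof.
move=> v0; have [/existsP[t vt]|/existsPn h] :=
    boolP [exists t, coord (vbasis {:V}) t v != 0].
  by exists (coord (vbasis {:V}) t); apply/eqP.
case: v0; rewrite (coord_vbasis (memvf v)) big1 // => t _.
by have /negbNE/eqP-> := h t; rewrite scale0r.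
Qed.

(* The truncation of X to paths of length at most N is a representation of a
   self-injective algebra, whence the uniserial objects of maximal length split
   off; concretely, a functional detecting the socle of the generated
   subobject induces a retraction up to an automorphism. *)
Lemma uniserial_split_off X (e : rep_hom X X) :
  nilpotent_rep X -> (forall i x, e i (e i x) = e i x) ->
  ~ (forall i x, e i x = 0) ->
  exists i N (a : rep_hom (uniserial k i N.+1) X) (b : rep_hom X (uniserial k i N.+1)),
    [/\ forall j u, b j (a j u) = u, forall j u, e j (a j u) = a j u
      & forall j x, b j (e j x) = b j x].
Proof.
move=> nilX ee e0.
have [N [j0 [i [x [eN v0]]]]] := longest_path nilX e0.
have [phi phiv] := exists_functional v0.
have [a as_] := rep_of_gen i (fun j => eN j0 j x).
have [j y|r rE] := @rep_of_functional _ _ _ _ e i N.+1 phi.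
  by rewrite eN linear0.
(* An endomorphism of the uniserial object that does not kill its socle is injective, hence
   invertible; its inverse turns [r] into a retraction. *)
pose c := rep_comp r (rep_comp e a).
have cs : c i (socle_gen k i N.+1) <> 0.
  move=> /(congr1 (coef 0)); rewrite !rep_compE rE ltn0Sn eqxx coef0 /=.
  by rewrite vertex_id1 id_lfunE as_ ee gpath_hom ee.
have [g [gc _]] := rep_iso_inv (mono_iso (uniserial_mono cs) (fun _ => erefl)).
exists i, N, (rep_comp e a), (rep_comp g r); split=> j y.
- by rewrite !rep_compE -[RHS]gc !rep_compE.
- by rewrite !rep_compE ee.
- rewrite !rep_compE; congr (g j _); apply: coef_inj => t.
  by rewrite !rE ee.
Qed.

(** [len] is the length minus one, so that summands are nonzero. The relations between [incl] and
    [proj] are left to [idempotent_decomposition]. *)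
Record summand X := Summand {
  socle : 'I_n;
  len : nat;
  incl : rep_hom (uniserial k socle len.+1) X;
  proj : rep_hom X (uniserial k socle len.+1)
}.

Definition summand_obj X (s : summand X) : rep k n :=
  uniserial k (socle s) (len s).+1.

(** The image of [e] is the direct sum of the images of [a] and of e - ab. This provides both the
    decreasing measure and the dimension count of the decomposition. *)
Lemma idempotent_rank X Y (e : rep_hom X X) (a : rep_hom Y X) (b : rep_hom X Y) j :
  (forall x, e j (e j x) = e j x) ->
  (forall u, b j (a j u) = u) -> (forall u, e j (a j u) = a j u) ->
  (forall x, b j (e j x) = b j x) ->
  \dim (limg (e j)) =
    (\dim {: Y j} + \dim (limg (rep_sub e (rep_comp a b) j)))%N.
Proof.
move=> ee ba ea be; set e' := rep_sub _ _ j.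
have e'E x : e' x = e j x - a j (b j x) by rewrite /e' rep_subE rep_compE.
have keru : lker (a j) == 0%VS.
  by apply/lker0P => u v /(congr1 (b j)); rewrite !ba.
rewrite -(@limg_dim_eq _ _ _ (a j)) ?(eqP keru) ?capv0 //.
rewrite -dimv_disjoint_sum.
  congr (\dim _); apply/eqP; rewrite eqEsubv subv_add; apply/and3P; split.
  - apply/subvP => _ /memv_imgP[x _ ->].
    have -> : e j x = a j (b j x) + e' x by rewrite e'E addrC subrK.
    by rewrite memv_add // memv_img // memvf.
  - by apply/subvP => _ /memv_imgP[u _ ->]; rewrite -ea memv_img // memvf.
  - apply/subvP => _ /memv_imgP[x _ ->].
    have -> : e' x = e j (e' x) by rewrite e'E linearB /= ee ea.
    by rewrite memv_img // memvf.
apply/eqP; rewrite -subv0; apply/subvP => v.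
rewrite memv_cap memv0 => /andP[/memv_imgP[u _ ->] /memv_imgP[x _ aue]].
have : b j (a j u) = b j (e' x) by rewrite aue.
by rewrite ba e'E linearB /= be ba subrr => ->; rewrite linear0.
Qed.

(** Induction on the total rank of [e], splitting off one uniserial object at a time. Idempotents of
    the fixed object [X] stand for its direct summands, so no complement has to be built as a
    representation. *)
Lemma idempotent_decomposition X (e : rep_hom X X) :
  nilpotent_rep X -> (forall i x, e i (e i x) = e i x) ->
  exists m (s : 'I_m -> summand X),
    [/\ forall j i u, proj (s j) i (incl (s j) i u) = u,
        forall j l i u, j != l -> proj (s l) i (incl (s j) i u) = 0,
        forall i x, \sum_(j < m) incl (s j) i (proj (s j) i x) = e i x
      & forall i, \dim (limg (e i)) = \sum_(j < m) \dim {: summand_obj (s j) i}].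
Proof.
move=> nilX; have := ltnSn (\sum_i \dim (limg (e i)))%N.
move: {2}(\sum_i \dim (limg (e i))).+1 => d.
elim: d e => // d IH e rk ee.
have [/forallP e0|] := boolP [forall i, e i == 0].
  exists 0, (fun j : 'I_0 => match j with Ordinal _ p => False_rect _ (notF p) end).
  split=> [[]|[]|i x|i] //; rewrite big_ord0 (eqP (e0 i)) ?zero_lfunE //.
  apply/eqP; rewrite dimv_eq0 -subv0; apply/subvP => _ /memv_imgP[x _ ->].
  by rewrite zero_lfunE memv0.
move=> /forallPn[i1 ei1].
have [|i [N [a [b [ba ea be]]]]] := uniserial_split_off nilX ee.
  move=> h; case/negP: ei1; apply/eqP/lfunP => x; by rewrite h zero_lfunE.
have rkE j := idempotent_rank (ee j) (ba j) (ea j) (be j).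
set e' := rep_sub e (rep_comp a b) in rkE.
have e'E j x : e' j x = e j x - a j (b j x) by rewrite /e' rep_subE rep_compE.
have ee' j x : e' j (e' j x) = e' j x.
  by rewrite e'E [e' j x]e'E !linearB /= ee ea ba be subrr addr0.
have be' j x : b j (e' j x) = 0 by rewrite e'E linearB /= be ba subrr.
have e'a j u : e' j (a j u) = 0 by rewrite e'E ea ba subrr.
have [|m [s [s1 s2 s3 s4]]] := IH e' _ ee'.
  rewrite -ltnS; apply: leq_trans rk; rewrite ltnS (eq_bigr _ (fun j _ => rkE j)).
  rewrite big_split /= -[X in (X < _)%N]add0n ltn_add2r (bigD1 i) //= addn_gt0.
  rewrite lt0n dimv_eq0; apply/orP; left; apply/eqP => z.
  apply: (@socle_gen_neq0 k n i N.+1) => //; apply/eqP.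
  by rewrite -memv0 -z memvf.
(* The summands obtained by induction lie in the image of e' and their projections factor through
   e', while [b] kills e' and e' kills [a]; hence they are orthogonal to the new summand. *)
have incl' j i' u : e' i' (incl (s j) i' u) = incl (s j) i' u.
  rewrite -s3 (bigD1 j) //= s1 big1 ?addr0 // => l lj.
  by rewrite s2 ?linear0 // eq_sym.
have proj' j i' x : proj (s j) i' (e' i' x) = proj (s j) i' x.
  rewrite -s3 linear_sum (bigD1 j) //= s1 big1 ?addr0 // => l lj.
  by rewrite s2.
pose s' (j : 'I_m.+1) := oapp s (Summand a b) (unlift ord0 j).
have s'0 : s' ord0 = Summand a b by rewrite /s' unlift_none.
have s'S j : s' (lift ord0 j) = s j by rewrite /s' liftK.
exists m.+1, s'; split.
- by move=> j i'; case: (unliftP ord0 j) => [j' ->|->]; rewrite ?s'S ?s'0.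
- move=> j l i'.
  case: (unliftP ord0 j) => [j' ->|->]; case: (unliftP ord0 l) => [l' ->|->];
    rewrite ?s'S ?s'0 //= => u.
  + by rewrite (inj_eq lift_inj); apply: s2.
  + by rewrite -incl' be'.
  + by rewrite -proj' e'a linear0.
- move=> i' x; rewrite big_ord_recl s'0 /=.
  rewrite (eq_bigr (fun j => incl (s j) i' (proj (s j) i' x))) => [|j _]; last first.
    by rewrite s'S.
  by rewrite s3 e'E addrC subrK.
- move=> i'; rewrite big_ord_recl s'0 rkE s4; congr (_ + _)%N.
  by apply: eq_bigr => j _; rewrite s'S.
Qed.

Lemma uniserial_decomposition X : nilpotent_rep X ->
  exists m (s : 'I_m -> summand X),
    [/\ is_direct_sum (fun j => summand_obj (s j)) X,
        forall j, rep_mono (incl (s j))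
      & dim_vec X = \sum_(j < m) interval_vec (socle (s j)) (len (s j)).+1].
Proof.
move=> nilX.
have [|m [s [s1 s2 s3 s4]]] := idempotent_decomposition (e := rep_id X) nilX.
  by move=> i x; rewrite /= !id_lfunE.
exists m, s; split.
- exists (fun j => incl (s j)), (fun j => proj (s j)); split=> [j i|j l i jl|i].
  + by apply/lfunP => u; rewrite comp_lfunE s1 id_lfunE.
  + by apply/lfunP => u; rewrite comp_lfunE s2 // zero_lfunE.
  + apply/lfunP => x; rewrite sum_lfunE -[RHS]s3.
    by apply: eq_bigr => j _; rewrite comp_lfunE.
- by move=> j i; apply: can_inj (s1 j i).
- apply/rowP => i; rewrite mxE summxE -(lim1g fullv) [\dim _]s4 -natz natr_sum.
  apply: eq_bigr => j _; rewrite -(uniserial_dim_vec k) mxE.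
  by rewrite natz.
Qed.

End Decomposition.

(** * Comparison of arguments by a cross product *)

Section Phases.
Variable R : realType.
Implicit Types h z : R[i].

Definition cross h z : R :=
  complex.Re h * complex.Im z - complex.Im h * complex.Re z.

Lemma cross_additive h : additive (cross h).
Proof. by move=> [a b] [c d]; rewrite /cross /=; ring. Qed.

HB.instance Definition _ h :=
  GRing.isAdditive.Build R[i] R (cross h) (cross_additive h).

Lemma crossxx h : cross h h = 0.
Proof. by rewrite /cross mulrC subrr. Qed.

Definition in_half_plane h := (h != 0) && (0 <= arg h < pi).

(** The cross product is |h| |z| sin(arg z - arg h), and the difference of two arguments in [0, pi)
    lies in (-pi, pi), where the sine has the sign of its argument. *)
Lemma cross_arg h z : in_half_plane h -> in_half_plane z ->
  (arg z < arg h) = (cross h z < 0) /\ (arg z == arg h) = (cross h z == 0).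
Proof.
move=> /and3P[h0 h1 h2] /and3P[z0 z1 z2].
have norm_gt0 w : w != 0 -> 0 < ComplexField.Normc.normc w.
  move=> w0; rewrite lt_def; case: w w0 => a b w0; rewrite sqrtr_ge0 andbT.
  by apply: contra w0 => /eqP/ComplexField.Normc.eq0_normc/eqP.
have [hr hi] := arg_polar h0; have [zr zi] := arg_polar z0.
have -> : cross h z = ComplexField.Normc.normc h * ComplexField.Normc.normc z
                      * sin (arg z - arg h).
  by rewrite /cross hr hi zr zi sinB; ring.
have p : 0 < ComplexField.Normc.normc h * ComplexField.Normc.normc z.
  by rewrite mulr_gt0 ?norm_gt0.
rewrite pmulr_rlt0 // mulf_eq0 (gt_eqF p) /=.
case: (ltgtP (arg z) (arg h)) => [lt|gt|->].
- have : 0 < sin (arg h - arg z).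
    by rewrite sin_gt0_pi // subr_gt0 lt (le_lt_trans _ h2) // gerBl.
  by rewrite -opprB sinN oppr_gt0 => s; rewrite s lt_eqF.
- have s : 0 < sin (arg z - arg h).
    by rewrite sin_gt0_pi // subr_gt0 gt (le_lt_trans _ z2) // gerBl.
  by rewrite ltNge (ltW s) gt_eqF.
- by rewrite subrr sin0 ltxx eqxx.
Qed.

End Phases.

(** * Slopes and stability of uniserial objects *)

Section Stability.
Variables (k : fieldType) (n : nat) (R : realType).
Variable Z : {additive 'rV[int]_n -> R[i]}.
Hypothesis Zstab : stability_function k Z.
Implicit Types (X Y : rep k n) (h : R[i]) (i : 'I_n).

Definition slope h (v : 'rV[int]_n) : R := cross h (Z v).

Lemma slopeD h u v : slope h (u + v) = slope h u + slope h v.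
Proof. by rewrite /slope !raddfD. Qed.

Lemma slope0 h : slope h 0 = 0.
Proof. by rewrite /slope !raddf0. Qed.

Lemma half_plane_rep X :
  nilpotent_rep X -> ~ zero_rep X -> in_half_plane (Z (dim_vec X)).
Proof. by move=> nX X0; have [z0 zr] := Zstab nX X0; rewrite /in_half_plane z0. Qed.

Section Slope.
Variable h : R[i].
Hypothesis h_half : in_half_plane h.

Lemma phase_ltE X : nilpotent_rep X -> ~ zero_rep X ->
  (phase Z X < arg h) = (slope h (dim_vec X) < 0).
Proof. by move=> nX X0; have [] := cross_arg h_half (half_plane_rep nX X0). Qed.

Lemma phase_eqE X : nilpotent_rep X -> ~ zero_rep X ->
  (phase Z X == arg h) = (slope h (dim_vec X) == 0).
Proof. by move=> nX X0; have [] := cross_arg h_half (half_plane_rep nX X0). Qed.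

Lemma phase_leE X : nilpotent_rep X -> ~ zero_rep X ->
  (phase Z X <= arg h) = (slope h (dim_vec X) <= 0).
Proof. by move=> nX X0; rewrite !le_eqVlt phase_ltE // phase_eqE. Qed.

Lemma uniserial_phase i l : (0 < l)%N -> slope h (interval_vec i l) = 0 ->
  phase Z (uniserial k i l) = arg h.
Proof.
move=> l0 s0; apply/eqP; rewrite phase_eqE ?uniserial_dim_vec ?s0 //.
  exact: uniserial_nilpotent.
exact: uniserial_neq0.
Qed.

(** By [uniserial_sub], every nonzero subobject has the class of an initial segment, so these are
    the only slopes to test. *)
Lemma uniserial_semistable i l :
  (0 < l)%N -> slope h (interval_vec i l) = 0 ->
  (forall s, (0 < s < l)%N -> slope h (interval_vec i s) <= 0) ->
  semistable_rep Z (uniserial k i l).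
Proof.
move=> l0 sl ss; split; [exact: uniserial_nilpotent|exact: uniserial_neq0|].
move=> Y f nY Y0 fm _; rewrite (uniserial_phase l0 sl) phase_leE //.
have [s [/andP[s0]]] := uniserial_sub fm Y0; rewrite leq_eqVlt => /orP[/eqP->|s_lt] ->.
  by rewrite sl.
by rewrite ss // s0.
Qed.

Lemma uniserial_stable i l :
  (0 < l)%N -> slope h (interval_vec i l) = 0 ->
  (forall s, (0 < s < l)%N -> slope h (interval_vec i s) < 0) ->
  stable_rep Z (uniserial k i l).
Proof.
move=> l0 sl ss; split; [exact: uniserial_nilpotent|exact: uniserial_neq0|].
move=> Y f nY Y0 fm fN; rewrite (uniserial_phase l0 sl) phase_ltE //.
have [s [/andP[s0]]] := uniserial_sub fm Y0; rewrite leq_eqVlt => /orP[/eqP->|s_lt] dY.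
  case: fN; apply: mono_iso => //; apply/dim_vec_eq.
  by rewrite dY uniserial_dim_vec.
by rewrite dY ss // s0.
Qed.

End Slope.

Lemma stable_semistable X : stable_rep Z X -> semistable_rep Z X.
Proof. by move=> [nX X0 Xs]; split=> // Y f nY Y0 fm fN; apply/ltW/(Xs Y f). Qed.

Lemma stable_simple X : stable_rep Z X ->
  simple_obj (semistable_cat k Z (phase Z X)) X.
Proof.
move=> Xs; have [nX X0 Xlt] := Xs.
split=> //; first by right; split=> //; apply: stable_semistable.
move=> Y f [Y0|[[nY Y0 _] pY]] fm; [by left|right].
(* For a monomorphism, being an isomorphism is decided by the dimension vectors. *)
have [/dim_vec_eq e|e] := eqVneq (dim_vec Y) (dim_vec X); first exact: mono_iso.
have : phase Z Y < phase Z X.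
  apply: (Xlt Y f) => // fi; move/eqP: e; case; apply/dim_vec_eq => i.
  by apply: iso_dim; exists f.
by rewrite pY ltxx.
Qed.

Lemma semistable_slope_sub X Y (f : rep_hom Y X) :
  semistable_rep Z X -> rep_mono f -> ~ zero_rep Y ->
  slope (Z (dim_vec X)) (dim_vec Y) <= 0.
Proof.
move=> [nX X0 Xle] fm Y0; have nY := nilpotent_sub fm nX.
have [->|e] := eqVneq (dim_vec Y) (dim_vec X); first by rewrite /slope crossxx.
rewrite -phase_leE //; last exact: half_plane_rep.
apply: (Xle Y f) => // fi; move/eqP: e; case; apply/dim_vec_eq => i.
by apply: iso_dim; exists f.
Qed.

(** * Consequences of discreteness *)

Hypothesis Zdisc : discrete_stability k Z.

Lemma unique_simple_stable X : stable_rep Z X ->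
  unique_simple (semistable_cat k Z (phase Z X)) X.
Proof.
move=> Xs; have Xsimple := stable_simple Xs; split=> // S' S's.
have [nX X0 _] := Xs; have [_ mu] := Zstab nX X0.
have [zc|[S [_ uS]]] := Zdisc mu.
  by case: X0; apply: zc; case: Xsimple.
by apply: iso_trans (uS _ S's) (iso_sym (uS _ Xsimple)).
Qed.

Lemma stable_iso X Y :
  stable_rep Z X -> stable_rep Z Y -> phase Z X = phase Z Y -> isomorphic X Y.
Proof.
move=> Xs Ys e; have [_] := unique_simple_stable Ys; apply.
by rewrite -e; apply: stable_simple.
Qed.

(* If a proper initial segment had slope 0, the shortest one and the shortest
   one following it would be two stable objects of the same phase with
   different socles. *)
Lemma uniserial_stable_discrete h i l : in_half_plane h ->
  (0 < l <= n)%N -> slope h (interval_vec i l) = 0 ->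
  (forall s, (0 < s < l)%N -> slope h (interval_vec i s) <= 0) ->
  stable_rep Z (uniserial k i l).
Proof.
move=> hh /andP[l0 ln] sl ss; apply: (uniserial_stable hh) => // r /andP[r0 rl].
rewrite lt_neqAle ss ?r0 // andbT; apply/negP => sr.
have ex_s : exists s, (0 < s)%N && (slope h (interval_vec i s) == 0).
  by exists r; rewrite r0.
case: (ex_minnP ex_s) => s /andP[s0 /eqP ss0] smin.
have sr_le : (s <= r)%N by apply: smin; rewrite r0.
set i' := iter s (@ordS n) i.
have slope' t : slope h (interval_vec i' t) = slope h (interval_vec i (s + t)).
  by rewrite interval_vecD slopeD ss0 add0r.
(* The segments of lengths [l] and [s] have slope 0, hence so does the remaining one, of length
   [l - s]. *)
have ex_t : exists t, (0 < t)%N && (slope h (interval_vec i' t) == 0).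
  by exists (l - s)%N; rewrite slope' subnKC ?sl ?eqxx ?andbT; lia.
case: (ex_minnP ex_t) => t /andP[t0 /eqP st0] tmin.
have tl : (t <= l - s)%N.
  by apply: tmin; rewrite slope' subnKC ?sl ?eqxx ?andbT; lia.
have st1 : stable_rep Z (uniserial k i s).
  apply: (uniserial_stable hh) => // u /andP[u0 us].
  rewrite lt_neqAle ss; last by lia.
  by rewrite andbT; apply/negP => uz; have := smin u; rewrite u0 uz; lia.
have st2 : stable_rep Z (uniserial k i' t).
  apply: (uniserial_stable hh) => // u /andP[u0 ut].
  rewrite lt_neqAle [in X in _ && X]slope' ss; last by lia.
  by rewrite andbT; apply/negP => uz; have := tmin u; rewrite u0 uz; lia.
(* The first object is nonzero at [i]; the second occupies the vertices i + s + u with 0 < s + u < l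
   <= n, which never return to [i]. *)
have := iso_dim i (stable_iso st1 st2 _).
rewrite !(uniserial_phase hh) // !uniserial_dim => /(_ erefl).
rewrite [RHS]eq_card0 => [e|u].
  by have := card0_eq e (Ordinal s0); rewrite !inE /= eqxx.
by rewrite !inE -iterD; apply/negbTE/iter_ordS_neq; have := ltn_ord u; lia.
Qed.

(** Summands are subobjects, so their slopes relative to [X] are nonpositive; they add up to 0,
    hence all vanish. Initial segments of a summand are subobjects of [X] too, which gives stability
    once the length is at most [n]. *)
Lemma semistable_decomposition X :
  semistable_rep Z X -> phase Z X <> arg (Z (const_mx 1)) ->
  exists m (S : 'I_m -> rep k n),
    (forall j, simple_obj (semistable_cat k Z (phase Z X)) (S j))
    /\ is_direct_sum S X.
Proof.
move=> Xss Xd; have [nX X0 _] := Xss; have hX := half_plane_rep nX X0.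
have [m [s [Xsum sm dX]]] := uniserial_decomposition nX.
exists m, (fun j => summand_obj (s j)); split=> // j.
pose h := Z (dim_vec X).
have sub j' t : (0 < t <= (len (s j')).+1)%N ->
    slope h (interval_vec (socle (s j')) t) <= 0.
  move=> /andP[t0 tl]; have [f fm] := uniserial_incl k (socle (s j')) tl.
  rewrite -(uniserial_dim_vec k).
  exact: semistable_slope_sub Xss (mono_comp (sm j') fm) (uniserial_neq0 t0).
have sj0 : slope h (interval_vec (socle (s j)) (len (s j)).+1) = 0.
  apply/eqP; rewrite eq_le sub //=.
  have : slope h (dim_vec X) = 0 by rewrite /slope crossxx.
  rewrite dX (bigD1 j) //= slopeD => /eqP; rewrite addr_eq0 => /eqP ->.
  rewrite oppr_ge0 (big_morph (slope h) (slopeD h) (slope0 h)) sumr_le0 // => l _.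
  by apply: sub; rewrite ltnSn.
(* Beyond length [n], the first [n] steps return to the socle vertex, so the rest is again an
   initial segment. Both pieces have nonpositive slope and total slope 0, which would give [X] the
   phase of delta. *)
have ln : ((len (s j)).+1 <= n)%N.
  rewrite leqNgt; apply/negP => nl; apply: Xd.
  have n0 : (0 < n)%N by apply: leq_ltn_trans (ltn_ord (socle (s j))).
  rewrite -(interval_vec_n (socle (s j))) -(uniserial_dim_vec k).
  apply/esym/eqP; rewrite -/(phase Z _) (phase_eqE hX); last 2 first.
  - exact: uniserial_nilpotent.
  - exact: uniserial_neq0.
  rewrite uniserial_dim_vec eq_le sub /=; last by lia.
  have := sj0; rewrite -[in interval_vec _ _](subnKC (ltnW nl)) interval_vecD slopeD.
  rewrite iter_ordS_n => /eqP; rewrite addr_eq0 => /eqP ->.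
  by rewrite oppr_ge0 sub //; lia.
have st : stable_rep Z (summand_obj (s j)).
  by apply: (uniserial_stable_discrete hX) => // t tl; apply: sub; lia.
have <- : phase Z (summand_obj (s j)) = phase Z X.
  exact: (uniserial_phase hX (ltn0Sn (len (s j))) sj0).
exact: stable_simple.
Qed.

Lemma semistable_cat_semisimple mu :
  mu <> arg (Z (const_mx 1)) -> semisimple_cat (semistable_cat k Z mu).
Proof.
move=> mud X [X0|[Xss muE]]; last first.
  by rewrite -muE; apply: semistable_decomposition; rewrite // muE.
(* The zero object is the empty direct sum; the families over ['I_0] are dummies. *)
exists 0, (fun=> X); split=> [[]//|].
exists (fun=> rep_id X), (fun=> rep_id X); split=> [[]//|[]//|i].
by apply/lfunP => x; rewrite big_ord0 zero_lfunE id_lfunE; apply/esym/X0.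
Qed.

(** * The stable object of class delta *)

Hypothesis n_gt0 : (0 < n)%N.
Let h := Z (const_mx 1).

Lemma delta_half_plane : in_half_plane h.
Proof.
rewrite /h -(interval_vec_n (Ordinal n_gt0)) -(uniserial_dim_vec k).
by apply: half_plane_rep; [exact: uniserial_nilpotent|exact: uniserial_neq0].
Qed.

Lemma slope_delta_period i m :
  slope h (interval_vec i (n + m)) = slope h (interval_vec i m).
Proof.
by rewrite interval_vecD iter_ordS_n slopeD interval_vec_n {1}/slope crossxx add0r.
Qed.

Lemma nonpositive_start :
  exists i, forall s, slope h (interval_vec i s) <= 0.
Proof.
pose i0 := Ordinal n_gt0; pose F (i : 'I_n) := slope h (interval_vec i0 i).
have [i _ imax] := Order.TotalTheory.arg_maxP F (isT : xpredT i0).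
exists i => s.
have iE : iter i (@ordS n) i0 = i.
  by apply: val_inj; rewrite /= val_iter_ordS add0n modn_small ?ltn_ord.
have per q r : slope h (interval_vec i0 (q * n + r)) = slope h (interval_vec i0 r).
  by elim: q => // q IH; rewrite mulSn -addnA slope_delta_period.
(* Full turns contribute nothing, so the slope of the segment from [i] is the value of [F] at i + s
   modulo [n] minus its maximal value [F i]. *)
have := imax (Ordinal (ltn_pmod (i + s) n_gt0)) isT.
rewrite /F /= -(per ((i + s) %/ n)%N) -divn_eq interval_vecD slopeD iE.
by rewrite gerDl.
Qed.

(* The uniserial object of length 2n with the socle of M is a nonsplit
   self-extension of M: unlike M, it is not killed by the paths of length n. *)
Lemma delta_not_semisimple i : (forall s, slope h (interval_vec i s) <= 0) ->
  unique_simple (semistable_cat k Z (arg h)) (uniserial k i n) ->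
  ~ semisimple_cat (semistable_cat k Z (arg h)).
Proof.
move=> ile [_ uM]; pose X := uniserial k i (n + n).
have sX : slope h (interval_vec i (n + n)) = 0.
  by rewrite slope_delta_period interval_vec_n /slope crossxx.
have nn : (0 < n + n)%N by lia.
have AX : semistable_cat k Z (arg h) X.
  right; split; last exact: (uniserial_phase delta_half_plane nn sX).
  by apply: (uniserial_semistable delta_half_plane).
move=> /(_ X AX)[m [S [Ssimple [inj [prj [_ _ XS]]]]]].
have killS j j0 j1 x : gpath (S j) n j0 j1 x = 0.
  have [f fi] := uM _ (Ssimple j).
  by apply: (mono_eq0 (iso_mono fi)); rewrite gpath_hom gpath_uniserial.
(* The basis vector e_n, which lives at i + n = i and is sent to e_0 by the path of length [n]. *)
pose g : X i := of_coef i (n + n) i (fun t => (t == n)%:R).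
have : gpath X n i i g = 0.
  have -> : g = \sum_(j < m) inj j i (prj j i g).
    rewrite -[LHS]id_lfunE -XS sum_lfunE.
    by apply: eq_bigr => j _; rewrite comp_lfunE.
  rewrite linear_sum big1 // => j _ /=.
  by rewrite -[LHS](gpath_hom (inj j)) killS linear0.
move=> /(congr1 (coef 0)); rewrite coef0 coef_gpath // coef_of_coef.
rewrite iter_ordS_n eqxx add0n eqxx -[X in (X < _)%N]addn0 ltn_add2l n_gt0.
by move/eqP; rewrite oner_eq0.
Qed.

Lemma discrete_delta_stable :
  exists M : rep k n,
    [/\ stable_rep Z M, dim_vec M = const_mx 1,
        forall M' : rep k n,
          stable_rep Z M' -> dim_vec M' = const_mx 1 -> isomorphic M' M
      & exists mu0 : R,
          [/\ 0 <= mu0 < pi,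
              ~ semisimple_cat (semistable_cat k Z mu0),
              unique_simple (semistable_cat k Z mu0) M
            & forall mu : R, 0 <= mu < pi ->
                ~ zero_cat (semistable_cat k Z mu) -> mu <> mu0 ->
                semisimple_cat (semistable_cat k Z mu)]].
Proof.
have hh := delta_half_plane; have [i ile] := nonpositive_start.
have si : slope h (interval_vec i n) = 0.
  by rewrite interval_vec_n /slope crossxx.
have Ms : stable_rep Z (uniserial k i n).
  by apply: (uniserial_stable_discrete hh); rewrite // n_gt0 leqnn.
have dM : dim_vec (uniserial k i n) = const_mx 1.
  by rewrite uniserial_dim_vec interval_vec_n.
have uM := unique_simple_stable Ms; rewrite /phase dM in uM.
exists (uniserial k i n); split=> // [M' M's dM'|].
  by apply: stable_iso => //; rewrite /phase dM' dM.
exists (arg h); split=> //.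
- by case/andP: hh.
- exact: delta_not_semisimple ile uM.
- by move=> mu _ _ mu0; apply: semistable_cat_semisimple.
Qed.

End Stability.

Theorem theorem2p8 (k : fieldType) (n : nat) (R : realType) (hn : (0 < n)%N) :
  (forall Z : {additive 'rV[int]_n -> R[i]},
     stability_function k Z -> discrete_stability k Z ->
     exists M : rep k n,
       [/\ stable_rep Z M, dim_vec M = const_mx 1,
           forall M' : rep k n,
             stable_rep Z M' -> dim_vec M' = const_mx 1 -> isomorphic M' M
         & exists mu0 : R,
             [/\ 0 <= mu0 < pi,
                 ~ semisimple_cat (semistable_cat k Z mu0),
                 unique_simple (semistable_cat k Z mu0) M
               & forall mu : R, 0 <= mu < pi ->
                   ~ zero_cat (semistable_cat k Z mu) -> mu <> mu0 ->
                   semisimple_cat (semistable_cat k Z mu)]]) /\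
  ~ (exists Z : {additive 'rV[int]_n -> R[i]},
       stability_function k Z /\ completely_discrete_stability k Z).
Proof.
split=> [Z Zstab Zdisc|[Z [Zstab [Zdisc Zss]]]].
  exact: discrete_delta_stable.
have [M [_ _ _ [mu0 [mu0_range nss _ _]]]] := discrete_delta_stable Zstab Zdisc hn.
exact: nss (Zss mu0 mu0_range).
Qed.
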